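(* Let $W_n$ be the squared cycle graph on $n$ vertices. Then the $3$-total cut complex satisfies \[ \Delta_3^t(W_n)\simeq \begin{cases} \mathbb{S}^{2n-17}, & n=9,10,\\ \mathbb{S}^{n-6}, & n\ge 11,\end{cases} \] where $\simeq$ denotes homotopy equivalence and $\mathbb{S}^d$ is the $d$-dimensional sphere.
   Context: The squared cycle graph $W_n$ is the graph with vertex set $[n]=\{1,\dots,n\}$ and edge set $\{\{i,i+1 \bmod n\},\{i,i+2 \bmod n\} : i=1,\dots,n\}$. For a graph $G=(V,E)$ and $k\ge 1$, the $k$-total cut complex $\Delta_k^t(G)$ is the simplicial complex on $V$ whose facets are the complements $V\setminus S$ of independent sets $S$ of $G$ with $|S|=k$; equivalently, $\sigma\subseteq V$ is a face iff $V\setminus\sigma$ contains an independent set of size $k$. *)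

(* Defs.v *)
From HB Require Import structures.
From mathcomp Require Import all_boot all_order all_algebra.
From mathcomp Require Import all_classical all_reals all_analysis.
From mathcomp Require Import Rstruct Rstruct_topology.
From Stdlib Require Rdefinitions.
Notation R := Rdefinitions.R.

Set Implicit Arguments.
Unset Strict Implicit.
Unset Printing Implicit Defensive.

Import Order.TTheory GRing.Theory Num.Theory.
Local Open Scope classical_set_scope.
Local Open Scope ring_scope.

(** The squared cycle graph W_n on the vertex set 'I_n = {0,...,n-1}
    (vertex i here corresponds to vertex i+1 of the paper):
    i ~ j iff i <> j and j = i+1, i+2 (mod n) or i = j+1, j+2 (mod n). *)
Definition sqcycle_adj (n : nat) (i j : 'I_n) : bool :=
  let a := nat_of_ord i in let b := nat_of_ord j in
  [&& a != b &
   [|| b == (a + 1) %% n, b == (a + 2) %% n,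
       a == (b + 1) %% n | a == (b + 2) %% n]]%N.

Definition independent (T : finType) (adj : rel T) (S : {set T}) : bool :=
  [forall x in S, forall y in S, ~~ adj x y].

(** sigma is a face of Delta_k^t(G) iff V \ sigma contains an independent
    set of size k (equivalently sigma is contained in the complement of
    an independent k-set, i.e. in a facet). *)
Definition total_cut_face (T : finType) (adj : rel T) (k : nat)
    (sigma : {set T}) : bool :=
  [exists S : {set T}, [&& independent adj S, #|S| == k & S \subset ~: sigma]].

Definition realization (n : nat) (face : {set 'I_n} -> bool)
    : set 'rV[R]_n :=
  [set x : 'rV[R]_n | (forall i, 0 <= x ord0 i) /\ \sum_i x ord0 i = 1 /\
           face (finset (fun i => x ord0 i != 0))].

Definition sphere (d : nat) : set 'rV[R]_d.+1 :=
  [set x : 'rV[R]_d.+1 | \sum_i (x ord0 i) ^+ 2 = 1].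

Definition unit_interval : set R := [set t | 0 <= t <= 1].

Definition homotopic_on (X Y : topologicalType) (A : set X) (A' : set Y)
    (f g : X -> Y) : Prop :=
  exists H : R * X -> Y,
    [/\ {within unit_interval `*` A, continuous H},
        (forall t x, unit_interval t -> A x -> A' (H (t, x))),
        (forall x, A x -> H (0, x) = f x) &
        (forall x, A x -> H (1, x) = g x)].

Definition homotopy_equivalent (X Y : topologicalType) (A : set X) (B : set Y)
    : Prop :=
  exists (f : X -> Y) (g : Y -> X),
    [/\ {within A, continuous f} /\ f @` A `<=` B,
        {within B, continuous g} /\ g @` B `<=` A,
        homotopic_on A A (g \o f) id &
        homotopic_on B B (f \o g) id].

Arguments sphere d : clear implicits.

(* Main.v *)
(** Pass to complements: a face of the total cut complex is a vertex set whose
    complement T contains an independent triple.  If no face containing a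
    nonempty sigma stops being a face when w is added, the faces containing
    sigma can be removed by a linear deformation which empties sigma into w; in
    terms of T, one discards the sets T avoiding sigma as soon as w is
    irrelevant for them.  For n >= 11 cut the cycle into five consecutive
    blocks, {0,1}, {2,3}, {4,5}, {6,7} and {8,...,n-1}.  A set meeting all five
    blocks contains an independent triple, because two windows of three
    consecutive vertices meet at most four blocks.  The sets T avoiding some
    block live on an arc; an independent triple in an arc may be chosen
    greedily from an end, so that the vertices next to its greedy end are
    irrelevant, and all these T can be discarded.  What remains, the T meeting
    every block, is the join of the boundaries of five simplices, a sphere of
    dimension n - 1 - 5.  For n = 9 and n = 10 the same works with seven and six
    blocks, not all of them intervals. *)
Require Import Defs.
From HB Require Import structures.
From mathcomp Require Import all_boot all_order all_algebra.
From mathcomp Require Import all_classical all_reals all_analysis.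
From mathcomp Require Import Rstruct Rstruct_topology.
From mathcomp Require Import zify ring lra.

Set Implicit Arguments.
Unset Strict Implicit.
Unset Printing Implicit Defensive.

Import Order.TTheory GRing.Theory Num.Theory.
Import numFieldNormedType.Exports.
Local Open Scope classical_set_scope.
Local Open Scope ring_scope.

(** * Limits of row vectors, finite sums and minima *)

Lemma cvg_mx_coord (T : Type) (F : set_system T) m n (K : realType)
    (f : T -> 'M[K]_(m, n)) (l : 'M[K]_(m, n)) {FF : Filter F} :
  (forall i j, f x i j @[x --> F] --> l i j) -> f x @[x --> F] --> l.
Proof.
move=> cvf A [P lP PA]; apply: filterS PA _ => /=.
have h i : \forall x \near F, forall j, P i j (f x i j).
  by apply: filter_forall => j; exact: cvf.
exact: filter_forall h.
Qed.

Lemma cvg_sum_real (K : realType) (T : Type) (F : set_system T)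
    (I : Type) (r : seq I) (P : pred I) (f : I -> T -> K) (l : I -> K) {FF : Filter F} :
  (forall i, P i -> f i x @[x --> F] --> l i) ->
  \sum_(i <- r | P i) f i x @[x --> F] --> \sum_(i <- r | P i) l i.
Proof.
apply: cvg_big => -[x y] /=.
apply: (@cvgD K K); [exact: cvg_fst|exact: cvg_snd].
Qed.

Lemma cvg_min_real (K : realType) (T : Type) (F : set_system T)
    (I : Type) (r : seq I) (P : pred I) (f : I -> T -> K) (l : I -> K) {FF : Filter F} :
  (forall i, P i -> f i x @[x --> F] --> l i) ->
  \big[Order.min/1]_(i <- r | P i) f i x @[x --> F] -->
  \big[Order.min/1]_(i <- r | P i) l i.
Proof.
apply: cvg_big => -[x y] /=.
exact: (@continuous_min K (K * K)%type fst snd (x, y) cvg_fst cvg_snd).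
Qed.

Lemma cvg_pair_comp (X Y Z : topologicalType) (T : Type) (F : set_system T)
    (H : X * Y -> Z) (f : T -> X) (g : T -> Y) a b {FF : Filter F} :
  continuous H -> f z @[z --> F] --> a -> g z @[z --> F] --> b ->
  H (f z, g z) @[z --> F] --> H (a, b).
Proof.
move=> cH fa gb.
apply: (@cvg_comp _ _ _ (fun z => (f z, g z)) H F (nbhs (a, b))); last exact: cH.
exact: cvg_pair.
Qed.

Lemma cvg_homotopy (K : realType) n (T : Type) (F : set_system T)
    (H : K * 'rV[K]_n -> 'rV[K]_n) (f : T -> K) (g : T -> 'rV[K]_n)
    (a : K) (b : 'rV[K]_n) {FF : Filter F} :
  continuous H -> f z @[z --> F] --> a -> g z @[z --> F] --> b ->
  H (f z, g z) @[z --> F] --> H (a, b).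
Proof. exact: (@cvg_pair_comp K 'rV[K]_n 'rV[K]_n). Qed.

(** * Deformation retracts and homotopy equivalence *)

(* The deformation is continuous on the whole ambient space, so that no pasting
   along subspaces is needed. *)
Definition deformation_retract (K : realType) n (A B : set 'rV[K]_n) : Prop :=
  B `<=` A /\ exists H : K * 'rV[K]_n -> 'rV[K]_n,
  [/\ continuous H,
      (forall t x, 0 <= t <= 1 -> A x -> A (H (t, x))),
      (forall x, A x -> H (0, x) = x),
      (forall x, A x -> B (H (1, x))) &
      (forall x, B x -> H (1, x) = x)].

Lemma deformation_retract_refl (K : realType) n (A : set 'rV[K]_n) :
  deformation_retract A A.
Proof. by split=> //; exists snd; split=> // x; exact: cvg_snd. Qed.

Lemma deformation_retract_trans (K : realType) n (A B C : set 'rV[K]_n) :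
  deformation_retract A B -> deformation_retract B C -> deformation_retract A C.
Proof.
move=> [BA [H1 [c1 in1 i1 r1 f1]]] [CB [H2 [c2 in2 i2 r2 f2]]].
split; first exact: subset_trans BA.
(* On the unit interval [lo] climbs from 0 to 1 in the first half and [hi] in the second; each is
   constant in the other half. *)
pose lo (t : K) := Order.min (2 * t) 1 : K.
pose hi (t : K) := Order.max (2 * t - 1) 0 : K.
have clo (t : K) (x : 'rV[K]_n) : lo z.1 @[z --> (t, x)] --> lo t.
  pose f (z : K * 'rV[K]_n) : K := 2 * z.1.
  have cf : f z @[z --> (t, x)] --> f (t, x).
    by apply: cvgM; [exact: cvg_cst|exact: cvg_fst].
  exact: (continuous_min cf (cvg_cst (1 : K))).
have chi (t : K) (x : 'rV[K]_n) : hi z.1 @[z --> (t, x)] --> hi t.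
  pose f (z : K * 'rV[K]_n) : K := 2 * z.1 - 1.
  have cf : f z @[z --> (t, x)] --> f (t, x).
    apply: cvgB; last exact: cvg_cst.
    by apply: cvgM; [exact: cvg_cst|exact: cvg_fst].
  exact: (continuous_max cf (cvg_cst (0 : K))).
have c11 (t : K) (x : 'rV[K]_n) : H1 (1, z.2) @[z --> (t, x)] --> H1 (1, x).
  apply: (cvg_homotopy (F := nbhs (t, x)) (f := fun=> 1) (g := snd) c1).
    exact: cvg_cst.
  exact: cvg_snd.
(* At every time one of the two homotopies is stationary at [H1 (1, x)], so this
   sum is their concatenation. *)
exists (fun z => H1 (lo z.1, z.2) + H2 (hi z.1, H1 (1, z.2)) - H1 (1, z.2)).
have split_t t : 0 <= t <= 1 ->
    (0 <= lo t <= 1 /\ hi t = 0) \/ (lo t = 1 /\ 0 <= hi t <= 1).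
  move=> /andP[t0 t1]; rewrite /lo /hi.
  case: (lerP (2 * t) 1) => h; [left|right].
    by rewrite max_r; [split=> //; apply/andP; split|]; lra.
  by rewrite max_l; [split=> //; apply/andP; split|]; lra.
have lo0 : lo 0 = 0 by rewrite /lo min_l; lra.
have hi0 : hi 0 = 0 by rewrite /hi max_r; lra.
have lo1 : lo 1 = 1 by rewrite /lo min_r; lra.
have hi1 : hi 1 = 1 by rewrite /hi max_l; lra.
split.
- move=> [t x]; apply: cvgB; last exact: c11.
  apply: cvgD.
    apply: (cvg_homotopy (F := nbhs (t, x)) (g := snd) c1 (clo t x)).
    exact: cvg_snd.
  exact: (cvg_homotopy c2 (chi t x) (c11 t x)).
- move=> t x tI Ax /=; have [[lt ->]|[-> ht]] := split_t t tI.
    by rewrite i2 ?addrK; [exact: in1|exact: r1].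
  by rewrite addrAC subrr add0r; apply/BA/in2 => //; exact: r1.
- by move=> x Ax /=; rewrite lo0 hi0 i1// i2 ?addrK//; exact: r1.
- by move=> x Ax /=; rewrite lo1 hi1 addrAC subrr add0r; apply/r2/r1.
- move=> x Cx /=; have Bx := CB _ Cx.
  by rewrite lo1 hi1 f1// f2// addrK.
Qed.

(** With [r] the end map of [H], the equivalence is [f \o r] with inverse [g]: one composite is [r],
    joined to the identity by [H]; the other is the identity because [r] fixes [B]. *)
Lemma homotopy_equivalent_of_retract n d (A B : set 'rV[R]_n)
    (S : set 'rV[R]_d) (f : 'rV[R]_n -> 'rV[R]_d) (g : 'rV[R]_d -> 'rV[R]_n) :
  deformation_retract A B ->
  (forall x, B x -> S (f x)) -> (forall u, S u -> B (g u)) ->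
  (forall x, B x -> g (f x) = x) -> (forall u, S u -> f (g u) = u) ->
  (forall x, B x -> f y @[y --> x] --> f x) ->
  (forall u, S u -> g v @[v --> u] --> g u) ->
  homotopy_equivalent A S.
Proof.
move=> [BA [H [cH inH H0 H1 HB]]] fS gB gfK fgK cf cg.
have cr (t : R) x : H (t, y) @[y --> x] --> H (t, x).
  apply: (cvg_homotopy (F := nbhs x) (f := fun=> t) (g := id) cH).
    exact: cvg_cst.
  exact: cvg_id.
exists (fun x => f (H (1, x))), g; split.
- split; last by move=> _ [x Ax <-]; exact/fS/H1.
  apply: continuous_in_subspaceT => x; rewrite inE => Ax.
  apply: (@cvg_comp _ _ _ (fun y => H (1, y)) f); first exact: cr.
  exact/cf/H1.
- split; last by move=> _ [x Ax <-]; exact/BA/gB.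
  by apply: continuous_in_subspaceT => x; rewrite inE => /cg.
(* Time is reversed: [H] starts at the identity, where [homotopic_on] has to end. *)
- exists (fun z => H (1 - z.1, z.2)); split.
  + apply: continuous_subspaceT => -[t x].
    apply: (cvg_homotopy (F := nbhs (t, x)) (f := fun z => 1 - z.1) (g := snd)
      (a := 1 - t) (b := x) cH); last exact: cvg_snd.
    by apply: (@cvgB R R^o); [exact: cvg_cst|exact: cvg_fst].
  + move=> t x /andP[t0 t1] Ax; apply: inH => //.
    by apply/andP; split => /=; lra.
  + by move=> x Ax /=; rewrite subr0 gfK//; exact: H1.
  + by move=> x Ax /=; rewrite subrr H0.
- exists snd; split=> //.
  + by apply: continuous_subspaceT => x; exact: cvg_snd.
  + by move=> u Su /=; rewrite HB ?fgK//; exact: gB.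
Qed.

(** * Complexes described by zero sets, and their collapses *)

(* The complement of the support; [nat -> bool] rather than [{set 'I_n}] keeps
   the combinatorics within linear arithmetic. *)
Definition zeros (K : realType) n (x : 'rV[K]_n) (i : nat) : bool :=
  [exists j : 'I_n, (j == i :> nat) && (x ord0 j == 0)].

Lemma zerosE (K : realType) n (x : 'rV[K]_n) (j : 'I_n) :
  zeros x j = (x ord0 j == 0).
Proof.
apply/existsP/idP => [[k /andP[/eqP/ord_inj->]]//|xj].
by exists j; rewrite eqxx.
Qed.

Lemma zeros_lt (K : realType) n (x : 'rV[K]_n) i : zeros x i -> (i < n)%N.
Proof. by case/existsP=> j /andP[/eqP<-]. Qed.

(** For [Q] closed under supersets this realizes the complex whose faces are the complements of the
    sets satisfying [Q]. *)
Definition cells (K : realType) n (Q : (nat -> bool) -> Prop) : set 'rV[K]_n :=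
  [set x : 'rV[K]_n | (forall i, 0 <= x ord0 i) /\ \sum_i x ord0 i = 1 /\
                       Q (zeros x)].

Arguments cells K n Q : clear implicits.

Lemma coord_le_sum (K : realType) n (x : 'rV[K]_n) j :
  (forall i, 0 <= x ord0 i) -> x ord0 j <= \sum_i x ord0 i.
Proof.
by move=> x0; rewrite (bigD1 j)//= lerDl sumr_ge0.
Qed.

Lemma cvg_coord (K : realType) n (T : Type) (F : set_system T)
    (f : T -> 'rV[K]_n) (l : 'rV[K]_n) j {FF : Filter F} :
  f z @[z --> F] --> l -> f z ord0 j @[z --> F] --> l ord0 j.
Proof.
move=> fl.
exact: (@cvg_comp _ _ _ f (fun M => M ord0 j) F (nbhs l) _ fl
  (@coord_continuous K 1 n ord0 j l)).
Qed.

(** The points to remove are positive on all vertices of [s]. The last hypothesis lets such a point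
    acquire weight at [w], so weight can flow from [s] to [w] until a coordinate in [s] vanishes. *)
Lemma cells_collapse (K : realType) n (Q : (nat -> bool) -> Prop) (s : seq nat)
    (w : nat) :
  (forall T T' : nat -> bool, (forall i, T i -> T' i) -> Q T -> Q T') ->
  has (fun i => i < n)%N s -> (w < n)%N -> w \notin s ->
  (forall T : nat -> bool, (forall i, T i -> (i < n)%N) -> Q T -> ~~ has T s ->
     Q (fun i => T i && (i != w))) ->
  deformation_retract (cells K n Q) (cells K n (fun T => Q T /\ has T s)).
Proof.
move=> monoQ /hasP[i0 i0s lti0] ltw ws step.
split; first by move=> x [x0 [x1 [Qx _]]].
pose inS (j : 'I_n) := val j \in s.
pose m (x : 'rV[K]_n) : K := \big[Order.min/1]_(j | inS j) x ord0 j.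
pose c (j : 'I_n) : K :=
  if inS j then -1 else if val j == w then #|inS|%:R else 0.
have sumc : \sum_j c j = 0.
  rewrite (bigID inS)/= (eq_bigr (fun=> -1)); last by move=> j jS; rewrite /c jS.
  rewrite sumr_const (bigD1 (Ordinal ltw))//= big1 ?addr0; last first.
    move=> j /andP[jS jw]; rewrite /c (negPf jS).
    by case: eqP => // E; case/eqP: jw; apply: val_inj.
  by rewrite /c /inS/= (negPf ws) eqxx mulNrn addNr.
(* Weight [t * m x] leaves each vertex of [s] for [w]; at [t = 1] some vertex of
   [s] has weight 0, and nothing moves when that was the case already. *)
pose H (z : K * 'rV[K]_n) : 'rV[K]_n :=
  \row_j (z.2 ord0 j + z.1 * m z.2 * c j).
have HE t x j : H (t, x) ord0 j = x ord0 j + t * m x * c j by rewrite mxE.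
have m_le x j : inS j -> m x <= x ord0 j by move=> jS; exact: bigmin_le_cond.
have m_ge0 (x : 'rV[K]_n) : (forall i, 0 <= x ord0 i) -> 0 <= m x.
  by move=> x0; apply: le_bigmin => //; exact: ler01.
(* The range contains [i0], and no coordinate exceeds the total weight 1, so the default 1 of the
   minimum does no harm. *)
have m_att (x : 'rV[K]_n) : (forall i, 0 <= x ord0 i) -> \sum_i x ord0 i = 1 ->
    exists2 j, inS j & m x = x ord0 j.
  move=> x0 x1; have i0S : inS (Ordinal lti0) by [].
  rewrite /m (@bigmin_eq_arg _ _ _ _ (Ordinal lti0) inS _ i0S); last first.
    by move=> j _; rewrite -x1; exact: coord_le_sum.
  by case: arg_minP => // j jS _; exists j.
have HK t x : m x = 0 -> H (t, x) = x.
  by move=> m0; apply/rowP => j; rewrite HE m0 mulr0 mul0r addr0.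
have sumH t x : \sum_i H (t, x) ord0 i = \sum_i x ord0 i.
  rewrite (eq_bigr (fun i => x ord0 i + t * m x * c i)); last by move=> *; exact: HE.
  by rewrite big_split/= -mulr_sumr sumc mulr0 addr0.
have H_ge0 t (x : 'rV[K]_n) : 0 <= t <= 1 -> (forall i, 0 <= x ord0 i) ->
    forall j, 0 <= H (t, x) ord0 j.
  move=> /andP[t0 t1] x0 j; rewrite HE /c; have mx := m_ge0 x x0.
  case: ifPn => [jS|_].
    rewrite mulrN1 subr_ge0; apply: le_trans (m_le x j jS).
    by rewrite ler_piMl.
  by case: ifP => _; rewrite ?mulr0 ?addr0// addr_ge0// !mulr_ge0.
have HQ t x : cells K n Q x -> Q (zeros (H (t, x))).
  move=> [x0 [x1 Qx]]; have [m0|mN0] := eqVneq (m x) 0; first by rewrite HK.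
  have mpos : 0 < m x by rewrite lt_def mN0 m_ge0.
  have nS j : inS j -> x ord0 j != 0.
    by move=> jS; rewrite gt_eqF// (lt_le_trans mpos)// m_le.
  (* Only [w] can leave the zero set, so upward closure of [Q] reduces the claim to [step]. *)
  apply: (monoQ (fun i => zeros x i && (i != w))); last first.
    apply: step Qx _; first exact: zeros_lt.
    apply/hasPn => i si; apply/negP => zi.
    have := zi; rewrite -[i]/(val (Ordinal (zeros_lt zi))) zerosE.
    by apply/negP/nS.
  move=> i /andP[zi iw]; have := zi; rewrite -[i]/(val (Ordinal (zeros_lt zi))).
  rewrite !zerosE HE => /eqP xi0; rewrite xi0 add0r /c.
  case: ifPn => [/nS|_]; first by rewrite xi0 eqxx.
  by rewrite /= (negPf iw) mulr0.
exists H; split.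
- move=> [t x]; apply: cvg_mx_coord => i j; rewrite mxE.
  rewrite [X in X @ _ --> _](_ : _ =
    (fun z : K * 'rV[K]_n => z.2 ord0 j + z.1 * m z.2 * c j)); last first.
    by apply/funext => z; rewrite mxE.
  have cx k : (z.2 : 'rV[K]_n) ord0 k @[z --> (t, x)] --> x ord0 k.
    apply: (cvg_coord (F := nbhs (t, x)) (f := snd)); exact: cvg_snd.
  apply: cvgD; first exact: cx.
  apply: cvgM; last exact: cvg_cst.
  apply: cvgM; first exact: cvg_fst.
  by apply: (cvg_min_real (F := nbhs (t, x))) => k _; exact: cx.
- move=> t x tI Ax; have [x0 [x1 _]] := Ax.
  by split; [exact: H_ge0|split; [rewrite sumH|exact: HQ]].
- by move=> x _; apply/rowP => j; rewrite HE !mul0r addr0.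
- move=> x Ax; have [x0 [x1 _]] := Ax.
  have I1 : 0 <= (1 : K) <= 1 by rewrite ler01 lexx.
  split; [exact: H_ge0|split; [by rewrite sumH|split; first exact: HQ]].
  have [j jS mj] := m_att x x0 x1.
  apply/hasP; exists (val j) => //.
  by rewrite zerosE HE /c jS mj mulrN1 mul1r subrr.
- move=> x [x0 [x1 [_ /hasP[i si zi]]]]; apply: HK; apply/eqP.
  have := zi; rewrite -[i]/(val (Ordinal (zeros_lt zi))) zerosE => /eqP xi.
  by rewrite eq_le m_ge0// andbT -xi m_le.
Qed.

(** * The join of simplex boundaries as a sphere *)

(* [B] is the join of the boundaries of the simplices spanned by the fibres of
   [r].  A point of [B] is recovered up to scale from the differences
   [x i - x (r i)], by subtracting their minimum on each fibre. *)
Lemma block_boundary_sphere (K : realType) n d (r : 'I_n -> 'I_n)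
    (e : 'I_d -> 'I_n) (B : set 'rV[K]_n) (S : set 'rV[K]_d) :
  (forall i, r (r i) = r i) -> injective e ->
  (forall k, r (e k) != e k) -> (forall i, r i != i -> exists k, e k = i) ->
  B = [set x : 'rV[K]_n | (forall i, 0 <= x ord0 i) /\ \sum_i x ord0 i = 1 /\
         forall i, exists2 j, r j = r i & x ord0 j = 0] ->
  S = [set u : 'rV[K]_d | \sum_k u ord0 k ^+ 2 = 1] ->
  exists (f : 'rV[K]_n -> 'rV[K]_d) (g : 'rV[K]_d -> 'rV[K]_n),
  [/\ (forall x, B x -> S (f x)) /\ (forall u, S u -> B (g u)),
      (forall x, B x -> g (f x) = x), (forall u, S u -> f (g u) = u),
      (forall x, B x -> f y @[y --> x] --> f x) &
      (forall u, S u -> g v @[v --> u] --> g u)].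
Proof.
move=> rr einj reN eP -> ->.
pose u (x : 'rV[K]_n) k : K := x ord0 (e k) - x ord0 (r (e k)).
pose N (x : 'rV[K]_n) : K := Num.sqrt (\sum_k u x k ^+ 2).
pose f (x : 'rV[K]_n) : 'rV[K]_d := \row_k (u x k / N x).
pose ext (v : 'rV[K]_d) (i : 'I_n) : K := \sum_(k | e k == i) v ord0 k.
pose low (v : 'rV[K]_d) (i : 'I_n) : K := \big[Order.min/1]_(j | r j == r i) ext v j.
pose y (v : 'rV[K]_d) (i : 'I_n) : K := ext v i - low v i.
pose g (v : 'rV[K]_d) : 'rV[K]_n := \row_i (y v i / \sum_j y v j).
have fE x k : f x ord0 k = u x k / N x by rewrite mxE.
have gE v i : g v ord0 i = y v i / \sum_j y v j by rewrite mxE.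
have ext_e v k : ext v (e k) = v ord0 k.
  by rewrite /ext (big_pred1 k)// => k'; rewrite (inj_eq einj).
have ext_r v i : ext v (r i) = 0.
  by rewrite /ext big_pred0// => k; apply/eqP => E; have := reN k; rewrite E rr eqxx.
(* The representative [r i] contributes 0, so the default 1 is never the minimum. *)
have low_att v i : exists2 j, r j = r i & low v i = ext v j.
  have : low v i <= 0 by rewrite -(ext_r v i); apply: bigmin_le_cond; rewrite rr.
  rewrite /low; elim/big_ind : _ => [|a b IHa IHb|j /eqP rj _].
  - by rewrite leNgt ltr01.
  - by case: (leP a b).
  - by exists j.
have y_ge0 v i : 0 <= y v i by rewrite subr_ge0; exact: bigmin_le_cond.
have low_r v i j : r i = r j -> low v i = low v j by rewrite /low => ->.
have y_e v k : y v (e k) - y v (r (e k)) = v ord0 k.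
  by rewrite /y ext_e ext_r (low_r v (r (e k)) (e k)) ?rr//; ring.
have y_sum (v : 'rV[K]_d) : \sum_k v ord0 k ^+ 2 = 1 -> 0 < \sum_j y v j.
  move=> v1; rewrite lt_def sumr_ge0 ?andbT; last by move=> *; exact: y_ge0.
  apply/negP; rewrite psumr_eq0; last by move=> *; exact: y_ge0.
  move=> /allP y0; have {}y0 i : y v i = 0.
    by apply/eqP; have := y0 i; rewrite mem_index_enum; exact.
  have := oner_neq0 K; rewrite -v1 big1 ?eqxx// => k _.
  by rewrite -y_e !y0 subrr expr0n.
have NE x : N x ^+ 2 = \sum_k u x k ^+ 2.
  by rewrite sqr_sqrtr// sumr_ge0// => k _; exact: sqr_ge0.
(* If all differences vanish, [x] is constant on each fibre, which contains a zero; hence [N] is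
   positive on [B]. *)
have u_r (x : 'rV[K]_n) i : (forall i, exists2 j, r j = r i & x ord0 j = 0) ->
    (forall k, u x k = 0) -> x ord0 i = 0.
  move=> xb u0; have xr j : x ord0 (r j) = x ord0 j.
    have [->//|/eP[k <-]] := eqVneq (r j) j.
    by apply/esym/eqP; rewrite -subr_eq0; apply/eqP/u0.
  by have [j rj xj] := xb i; rewrite -xr -rj xr.
have N_gt0 (x : 'rV[K]_n) : \sum_i x ord0 i = 1 ->
    (forall i, exists2 j, r j = r i & x ord0 j = 0) -> 0 < N x.
  move=> x1 xb; rewrite lt_def sqrtr_ge0 andbT.
  apply/eqP => N0; have := NE x; rewrite N0 expr0n/= => /esym/eqP.
  rewrite psumr_eq0; last by move=> *; exact: sqr_ge0.
  move=> /allP u0; have {}u0 k : u x k = 0.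
    by apply/eqP; rewrite -sqrf_eq0; have := u0 k; rewrite mem_index_enum; exact.
  have := oner_neq0 K; rewrite -x1 big1 ?eqxx// => i _; exact: u_r.
have extf x i : ext (f x) i = (x ord0 i - x ord0 (r i)) / N x.
  have [ri|/eP[k <-]] := eqVneq (r i) i; last by rewrite ext_e fE.
  by rewrite -{1}ri ext_r ri subrr mul0r.
have yf (x : 'rV[K]_n) i : (forall i, 0 <= x ord0 i) -> \sum_i x ord0 i = 1 ->
    (forall i, exists2 j, r j = r i & x ord0 j = 0) ->
    y (f x) i = x ord0 i / N x.
  move=> x0 x1 xb; have Npos := N_gt0 x x1 xb.
  (* The minimum over the fibre is reached at a zero of [x]. *)
  suff lowE : low (f x) i = - x ord0 (r i) / N x by rewrite /y lowE extf; ring.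
  apply/eqP; rewrite eq_le; apply/andP; split.
    have [j rj xj] := xb i.
    have -> : - x ord0 (r i) / N x = ext (f x) j by rewrite extf xj rj sub0r.
    by apply: bigmin_le_cond; rewrite rj.
  have [j rj ->] := low_att (f x) i.
  by rewrite extf rj ler_pM2r ?invr_gt0// lerBrDr addNr.
have cu x k : u z k @[z --> x] --> u x k.
  by apply: (@cvgB K K _ (nbhs x)); exact: coord_continuous.
have cext v i : ext z i @[z --> v] --> ext v i.
  apply: (cvg_sum_real (F := nbhs v)) => k _.
  exact: coord_continuous.
have cy v i : y z i @[z --> v] --> y v i.
  apply: (@cvgB K K _ (nbhs v)); first exact: cext.
  by apply: (cvg_min_real (F := nbhs v)) => j _; exact: cext.
exists f, g; split; first split.
- move=> x [x0 [x1 xb]]; have Npos := N_gt0 x x1 xb.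
  rewrite /= (eq_bigr (fun k => u x k ^+ 2 / N x ^+ 2)).
    by rewrite -mulr_suml -NE divff// sqrf_eq0 gt_eqF.
  by move=> k _; rewrite fE expr_div_n.
- move=> v v1; have ypos := y_sum v v1; split; last split.
  + by move=> i; rewrite gE divr_ge0// ltW.
  + rewrite (eq_bigr (fun i => y v i / \sum_j y v j)).
      by rewrite -mulr_suml divff// gt_eqF.
    by move=> i _; rewrite gE.
  + move=> i; have [j rj lj] := low_att v i; exists j => //.
    by rewrite gE /y (low_r v j i rj) lj subrr mul0r.
- move=> x [x0 [x1 xb]]; have Npos := N_gt0 x x1 xb.
  apply/rowP => i; rewrite gE (eq_bigr (fun j => x ord0 j / N x)).
    by rewrite yf// -mulr_suml x1 mul1r invrK divfK// gt_eqF.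
  by move=> j _; rewrite yf.
- move=> v v1; have ypos := y_sum v v1.
  have ug k : u (g v) k = v ord0 k / \sum_j y v j.
    by rewrite /u !gE -mulrBl y_e.
  have Ng : N (g v) = (\sum_j y v j)^-1.
    rewrite /N (eq_bigr (fun k => v ord0 k ^+ 2 / (\sum_j y v j) ^+ 2)).
      rewrite -mulr_suml v1 mul1r -exprVn sqrtr_sqr ger0_norm// invr_ge0.
      exact: ltW.
    by move=> k _; rewrite ug expr_div_n.
  by apply/rowP => k; rewrite fE ug Ng invrK divfK// gt_eqF.
- move=> x [x0 [x1 xb]]; have Npos := N_gt0 x x1 xb.
  apply: (cvg_mx_coord (F := nbhs x)) => i k; rewrite ord1 fE.
  rewrite [X in X @ _ --> _](_ : _ = (fun z => u z k / N z)); last first.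
    by apply/funext => z; rewrite fE.
  apply: (@cvgM K _ (nbhs x)); first exact: cu.
  apply: (@cvgV K _ (nbhs x)); first by rewrite gt_eqF.
  apply: (@cvg_comp _ _ _ (fun z => \sum_k u z k ^+ 2) Num.sqrt (nbhs x)
    (nbhs (\sum_k u x k ^+ 2))); last exact: sqrt_continuous.
  apply: (cvg_sum_real (F := nbhs x)) => k' _.
  by rewrite expr2; apply: (@cvgM K _ (nbhs x)); exact: cu.
- move=> v v1; have ypos := y_sum v v1.
  apply: (cvg_mx_coord (F := nbhs v)) => i k; rewrite ord1 gE.
  rewrite [X in X @ _ --> _](_ : _ = (fun z => y z k / \sum_j y z j)); last first.
    by apply/funext => z; rewrite gE.
  apply: (@cvgM K _ (nbhs v)); first exact: cy.
  apply: (@cvgV K _ (nbhs v)); first by rewrite gt_eqF.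
  by apply: (cvg_sum_real (F := nbhs v)) => j _; exact: cy.
Qed.

(** * Independent triples of the squared cycle *)

(** For [5 <= n] these are the independent triples listed in increasing order; the last inequality
    is the gap across 0. *)
Definition spread (n : nat) (T : nat -> bool) : Prop :=
  exists a b c, [/\ T a, T b, T c & [/\ a + 3 <= b, b + 3 <= c & c + 3 <= a + n]]%N.

Lemma modn_wrap a k n : (a < n)%N -> (k <= n)%N ->
  ((a + k) %% n = if a + k < n then a + k else a + k - n)%N.
Proof.
move=> an kn; case: ifPn => h; first by rewrite modn_small.
rewrite -[in LHS](@subnK n (a + k)); last by lia.
by rewrite modnDr modn_small; lia.
Qed.

Lemma sqcycle_nonadjE n (i j : 'I_n) : (5 <= n)%N -> (i < j)%N ->
  ~~ sqcycle_adj i j = (i + 3 <= j)%N && (j + 3 <= i + n)%N.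
Proof.
move=> n5 ij; rewrite /sqcycle_adj.
have := ltn_ord i; have := ltn_ord j.
move: (nat_of_ord i) (nat_of_ord j) ij => a b ab bn an.
rewrite !modn_wrap//; try lia.
by do 4 case: ifP => ?; lia.
Qed.

Lemma sqcycle_adjC n : symmetric (@sqcycle_adj n).
Proof.
move=> i j; rewrite /sqcycle_adj eq_sym; congr (_ && _).
by do 4 case: (_ == _).
Qed.

Lemma total_cut_face_spread n (T : nat -> bool) (sigma : {set 'I_n}) :
  (5 <= n)%N -> (forall j : 'I_n, T j = (j \notin sigma)) ->
  (forall i, T i -> (i < n)%N) ->
  total_cut_face (@sqcycle_adj n) 3 sigma <-> spread n T.
Proof.
move=> n5 TE Tn; split.
  move=> /existsP[S /and3P[/forallP indS /eqP S3 /fintype.subsetP Ssig]].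
  (* Listing [S] by increasing value lets independence be read as gap conditions. *)
  have srt : sorted (relpre val ltn) (enum S).
    rewrite /enum_mem; apply: sorted_filter; first by move=> ? ? ?; exact: ltn_trans.
    by rewrite -sorted_map -enumT val_enum_ord iota_ltn_sorted.
  have memS x : (x \in enum S) = (x \in S) by rewrite mem_enum.
  have := S3; rewrite cardE; move: srt memS.
  case: (enum S) => [|x [|y [|z [|]]]]//= /and3P[xy yz _] memS _.
  have nonadj u v : u \in S -> v \in S -> ~~ sqcycle_adj u v.
    move=> uS vS; have := indS u; rewrite uS/= => /forallP/(_ v).
    by rewrite vS.
  have inS u : u \in [:: x; y; z] -> u \in S by rewrite memS.
  have xS : x \in S by apply: inS; rewrite !inE eqxx.
  have yS : y \in S by apply: inS; rewrite !inE eqxx orbT.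
  have zS : z \in S by apply: inS; rewrite !inE eqxx !orbT.
  have TS u : u \in S -> T u by rewrite TE => /Ssig; rewrite inE.
  have := nonadj _ _ xS yS; have := nonadj _ _ yS zS; have := nonadj _ _ xS zS.
  rewrite !sqcycle_nonadjE//; last exact: ltn_trans yz.
  move=> xz' yz' xy'; exists x, y, z; split; [exact: TS..|].
  by split; lia.
move=> [a [b [c [Ta Tb Tc [ab bc ca]]]]].
pose x := Ordinal (Tn _ Ta); pose y := Ordinal (Tn _ Tb); pose z := Ordinal (Tn _ Tc).
have nadj u v : u \in [:: x; y; z] -> v \in [:: x; y; z] -> ~~ sqcycle_adj u v.
  wlog uv : u v / (u <= v)%N => [wl|].
    case: (leqP u v) => [/wl//|vu] uS vS.
    by rewrite sqcycle_adjC; apply: wl => //; exact: ltnW.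
  case: (ltngtP u v) uv => // [uv|uv] _.
    rewrite sqcycle_nonadjE// !inE -!val_eqE/=; lia.
  by rewrite /sqcycle_adj uv eqxx.
apply/existsP; exists (x |: (y |: finset.set1 z))%SET; apply/and3P; split.
- apply/forallP => u; apply/implyP => uS; apply/forallP => v; apply/implyP => vS.
  by apply: nadj; move: uS vS; rewrite !inE.
- rewrite !cardsU1 cards1 !inE -!val_eqE/=; apply/eqP.
  by have [-> [-> ->]] : (a == b = false /\ a == c = false /\ b == c = false)%N by lia.
- apply/fintype.subsetP => u; rewrite !inE -TE => /or3P[] /eqP->;
    [exact: Ta|exact: Tb|exact: Tc].
Qed.

(** * Families of sets meeting prescribed blocks *)

Definition hitting (n : nat) (L : seq (seq nat)) (T : nat -> bool) : Prop :=
  spread n T /\ all (has T) L.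

Lemma realization_hitting n : (5 <= n)%N ->
  realization (total_cut_face (@sqcycle_adj n) 3) = cells R n (hitting n [::]).
Proof.
move=> n5; apply/seteqP; split=> x [x0 [x1 xF]]; split=> //; split=> //.
  split=> //; apply/total_cut_face_spread; [exact: n5| |exact: zeros_lt|exact: xF].
  by move=> j; rewrite zerosE inE negbK.
apply/(total_cut_face_spread (T := zeros x)) => //; [|exact: zeros_lt|by case: xF].
by move=> j; rewrite zerosE inE negbK.
Qed.

Lemma hitting_mono n L (T T' : nat -> bool) :
  (forall i, T i -> T' i) -> hitting n L T -> hitting n L T'.
Proof.
move=> TT' [[a [b [c [Ta Tb Tc h]]]] LT]; split.
  by exists a, b, c; split=> //; exact: TT'.
by apply: sub_all LT => s; exact: sub_has.
Qed.

(** [L'] need only impose the same conditions as [s :: L], so a block of [L] made redundant by [s]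
    may be dropped. *)
Lemma hitting_collapse n L L' s w :
  has (fun i => i < n)%N s -> (w < n)%N -> w \notin s ->
  (forall T : nat -> bool, (forall i, T i -> (i < n)%N) -> spread n T ->
     all (has T) L -> ~~ has T s -> hitting n L (fun i => T i && (i != w))) ->
  (forall T, all (has T) L' = has T s && all (has T) L) ->
  deformation_retract (cells R n (hitting n L)) (cells R n (hitting n L')).
Proof.
move=> sn wn ws step LE.
have -> : cells R n (hitting n L') = cells R n (fun T => hitting n L T /\ has T s).
  apply/seteqP; split=> x [x0 [x1 xQ]]; split=> //; split=> //.
    by case: xQ => sp; rewrite LE => /andP[].
  by case: xQ => -[sp h1] h2; split=> //; rewrite LE h1 h2.
apply: (@cells_collapse _ _ _ _ w) => //; first exact: hitting_mono.
by move=> T bT [spT LT]; exact: step.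
Qed.

(** The blocks are the fibres of [r], and [r i <= i] keeps the representatives below [n]. The other
    vertices index the coordinates of the space around the sphere, whence [d.+1] of them. *)
Lemma hitting_sphere n d L (r : nat -> nat) :
  (5 <= n)%N ->
  deformation_retract (cells R n (hitting n [::])) (cells R n (hitting n L)) ->
  (forall i, r i <= i)%N -> (forall i, r (r i) = r i) ->
  count (fun i => r i != i) (iota 0 n) = d.+1 ->
  (forall T : nat -> bool, (forall i, T i -> (i < n)%N) ->
     hitting n L T <-> (forall i, (i < n)%N -> exists2 j, r j = r i & T j)) ->
  homotopy_equivalent (realization (total_cut_face (@sqcycle_adj n) 3)) (sphere d).
Proof.
move=> n5 defL r_le rr rd LE; rewrite realization_hitting//.
pose r' (i : 'I_n) : 'I_n := Ordinal (leq_ltn_trans (r_le i) (ltn_ord i)).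
have cardr : #|[pred i | r' i != i]| = d.+1.
  rewrite cardE /enum_mem size_filter -enumT -rd -val_enum_ord count_map.
  by apply: eq_count => i.
pose e (k : 'I_d.+1) : 'I_n := enum_val (cast_ord (esym cardr) k).
have eN k : r' (e k) != e k by have := enum_valP (cast_ord (esym cardr) k).
have rr' i : r' (r' i) = r' i by apply: val_inj; rewrite /= rr.
have einj : injective e by move=> k k' /enum_val_inj/cast_ord_inj.
have eP i : r' i != i -> exists k, e k = i.
  move=> ri; have iA : i \in [pred i | r' i != i] by [].
  exists (cast_ord cardr (enum_rank_in iA i)).
  by rewrite /e cast_ordK enum_rankK_in.
have BE : cells R n (hitting n L) = [set x : 'rV[R]_n | (forall i, 0 <= x ord0 i) /\
    \sum_i x ord0 i = 1 /\ forall i, exists2 j, r' j = r' i & x ord0 j = 0].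
  apply/seteqP; split=> x [x0 [x1 xQ]]; split=> //; split=> //.
    move=> i; have /(LE _ (@zeros_lt _ _ x))/(_ i (ltn_ord i))[j rj xj] := xQ.
    exists (Ordinal (zeros_lt xj)); first exact: val_inj.
    by apply/eqP; rewrite -zerosE.
  apply/LE; first exact: zeros_lt.
  move=> i ltin; have [j /(congr1 val) rj xj] := xQ (Ordinal ltin).
  by exists j => //; rewrite zerosE xj.
have [f [g [[fS gB] gfK fgK cf cg]]] :=
  block_boundary_sphere rr' einj eN eP BE (erefl (sphere d)).
exact: (homotopy_equivalent_of_retract defL fS gB gfK fgK cf cg).
Qed.

(** * Certificates checked by enumeration, for n = 9 and n = 10 *)

(* Conditionals rather than [&&] and [==>]: [vm_compute] evaluates both arguments
   of the latter. *)
Definition spreadb (n : nat) (T : nat -> bool) : bool :=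
  has (fun a => if T a then
    has (fun b => if T b then has T (iota (b + 3) (a + n - (b + 5))) else false)
      (iota (a + 3) (n - (a + 3))) else false) (iota 0 n).

(** The range of [c] in [spreadb] stops at [a + n - 3]; truncated subtraction makes it empty when no
    [c] fits. *)
Lemma spreadP n (T : nat -> bool) : (forall i, T i -> (i < n)%N) ->
  reflect (spread n T) (spreadb n T).
Proof.
move=> Tn; apply: (iffP hasP) => [[a _]|[a [b [c [Ta Tb Tc [ab bc ca]]]]]].
  case: ifP => // Ta /hasP[b]; case: ifP => // Tb b_in /hasP[c c_in Tc].
  by exists a, b, c; split=> //; move: b_in c_in; rewrite !mem_iota => *; split; lia.
have bn := Tn _ Tb; exists a; first by rewrite mem_iota /= Tn.
rewrite Ta; apply/hasP; exists b; first by rewrite mem_iota; lia.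
by rewrite Tb; apply/hasP; exists c => //; rewrite mem_iota; lia.
Qed.

Fixpoint bitseqs (n : nat) : seq bitseq :=
  if n is m.+1 then [seq b :: t | b <- [:: true; false], t <- bitseqs m]
  else [:: [::]].

Lemma mem_bitseqs (t : bitseq) : t \in bitseqs (size t).
Proof.
elim: t => //= b t IH; rewrite cats0 mem_cat.
by case: b; rewrite map_f ?orbT.
Qed.

(** By function extensionality a set supported below [n] is its table of [n] bits, so a finite check
    covers all of them. *)
Lemma all_bitseqsP n (P : (nat -> bool) -> bool) :
  all (fun t => P (nth false t)) (bitseqs n) ->
  forall T : nat -> bool, (forall i, T i -> (i < n)%N) -> P T.
Proof.
move=> /allP allP T Tn.
have -> : T = nth false (mkseq T n).
  apply/funext => i; case: (ltnP i n) => [lt|ge]; first by rewrite nth_mkseq.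
  rewrite nth_default ?size_mkseq//; apply/negP => /Tn.
  by rewrite ltnNge ge.
by apply: allP; have := mem_bitseqs (mkseq T n); rewrite size_mkseq.
Qed.

Definition hittingb n L T := spreadb n T && all (has T) L.

Lemma hittingbP n L (T : nat -> bool) : (forall i, T i -> (i < n)%N) ->
  reflect (hitting n L T) (hittingb n L T).
Proof.
by move=> Tn; apply: (iffP andP) => -[/(spreadP Tn) ? ?].
Qed.

(** A certificate: each pair [(s, w)] forces the block [s] by toggling [w], and the irrelevance of
    [w] is checked on all sets. *)
Fixpoint moves_ok n L (ms : seq (seq nat * nat)) : bool :=
  if ms is (s, w) :: ms' then
    [&& has (fun i => i < n)%N s, (w < n)%N, w \notin s,
        all (fun t => let T := nth false t in
          if has T s then true else if hittingb n L T then
          hittingb n L (fun i => T i && (i != w)) else true)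
          (bitseqs n) & moves_ok n (s :: L) ms']
  else true.

Lemma moves_collapse n L ms : moves_ok n L ms ->
  deformation_retract (cells R n (hitting n L))
    (cells R n (hitting n (catrev (map fst ms) L))).
Proof.
elim: ms L => [|[s w] ms IH] L /=; first by move=> _; exact: deformation_retract_refl.
move=> /and5P[sn wn ws stp /IH]; apply: deformation_retract_trans.
apply: (@hitting_collapse _ _ _ s w) => // T Tn spT LT sT.
apply/hittingbP; first by move=> i /andP[/Tn].
pose P T := if has T s then true else if hittingb n L T then
  hittingb n L (fun i => T i && (i != w)) else true.
have := @all_bitseqsP n P stp T Tn.
rewrite /P (negPf sT) ifT//.
exact/hittingbP.
Qed.

(** The last check identifies the surviving sets with those meeting every fibre of [r]; in
    particular, meeting every fibre must force an independent triple. *)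
Lemma moves_sphere n d ms (r : nat -> nat) :
  (5 <= n)%N -> moves_ok n [::] ms ->
  (forall i, r i <= i)%N -> (forall i, r (r i) = r i) ->
  count (fun i => r i != i) (iota 0 n) = d.+1 ->
  all (fun t => let T := nth false t in
    hittingb n (catrev (map fst ms) [::]) T ==
    all (fun i => has (fun j => (r j == r i) && T j) (iota 0 n)) (iota 0 n))
    (bitseqs n) ->
  homotopy_equivalent (realization (total_cut_face (@sqcycle_adj n) 3)) (sphere d).
Proof.
move=> n5 ok r_le rr rd fin.
apply: (hitting_sphere n5 (moves_collapse ok) r_le rr rd) => T Tn.
pose P T := hittingb n (catrev (map fst ms) [::]) T ==
  all (fun i => has (fun j => (r j == r i) && T j) (iota 0 n)) (iota 0 n).
have /eqP E := @all_bitseqsP n P fin T Tn.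
split=> [/(hittingbP _ Tn)|h].
  rewrite E => /allP h i ltin; have := h i; rewrite mem_iota ltin => /(_ isT).
  by move=> /hasP[j _ /andP[/eqP]]; exists j.
apply/(hittingbP _ Tn); rewrite E; apply/allP => i; rewrite mem_iota => /h[j rj Tj].
by apply/hasP; exists j; rewrite ?mem_iota ?Tn// rj eqxx.
Qed.

(** The only independent triples are {0,3,6}, {1,4,7} and {2,5,8}, so avoiding one vertex of a
    triple makes its other two irrelevant. This forces 3, ..., 8; then a set avoiding 0, 1, 2 has no
    triple, and the boundary of the triangle {0,1,2} remains. *)
Lemma sphere_case9 :
  homotopy_equivalent (realization (total_cut_face (@sqcycle_adj 9) 3)) (sphere 1).
Proof.
apply: (@moves_sphere _ _ [:: ([:: 3], 0); ([:: 4], 1); ([:: 5], 2); ([:: 6], 0);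
  ([:: 7], 1); ([:: 8], 2); ([:: 0; 1; 2], 3)] (fun i => if i < 3 then 0 else i))%N.
- by [].
- by vm_compute.
- by move=> i; case: ifP.
- by move=> i; case: (ltnP i 3) => //= h; rewrite ltnNge h.
- by [].
- by vm_compute.
Qed.

(* The blocks and the moves were found by a computer search. *)
Lemma sphere_case10 :
  homotopy_equivalent (realization (total_cut_face (@sqcycle_adj 10) 3)) (sphere 3).
Proof.
(* The fibres below 10 are {0,1,2}, {3,7}, {4}, {5,9}, {6} and {8}. The blocks {0,4} and {2,4} are
   auxiliary: they become redundant once 4 is forced. *)
apply: (@moves_sphere _ _ [:: ([:: 0; 4], 7); ([:: 2; 4], 9); ([:: 4], 1);
  ([:: 6], 3); ([:: 8], 5); ([:: 3; 7], 0); ([:: 5; 9], 2); ([:: 0; 1; 2], 5)]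
  (fun i => nth i [:: 0; 0; 0; 3; 4; 5; 6; 3; 8; 5] i))%N.
- by [].
- by vm_compute.
- by move=> i; do 10 (case: i => [|i] //); rewrite /= nth_nil.
- by move=> i; do 10 (case: i => [|i] //); rewrite /= nth_nil /= nth_nil.
- by [].
- by vm_compute.
Qed.

(** * Forced vertices and block moves for n >= 11 *)

(** Yields the vertex forced into [T] when it meets one block and avoids all but one vertex of
    it. *)
Lemma has_avoid (T : nat -> bool) s s' v : has T s -> ~~ has T s' ->
  (forall x, x \in s -> x \notin s' -> x = v) -> T v.
Proof.
move=> /hasP[x xs Tx] /hasPn s'T xv.
by rewrite -(xv x)//; apply/negP => /s'T; rewrite Tx.
Qed.

Lemma notin_avoid (T : nat -> bool) s x : ~~ has T s -> T x -> x \notin s.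
Proof. by move=> /hasPn sT Tx; apply/negP => /sT; rewrite Tx. Qed.

Lemma has_removeN (T : nat -> bool) s w : w \notin s -> has T s ->
  has (fun i => T i && (i != w)) s.
Proof.
move=> ws /hasP[x xs Tx]; apply/hasP; exists x => //.
by rewrite Tx; apply: contraNneq ws => <-.
Qed.

Lemma has_remove (T : nat -> bool) s w x : x \in s -> T x -> x != w ->
  has (fun i => T i && (i != w)) s.
Proof. by move=> xs Tx xw; apply/hasP; exists x => //; rewrite Tx. Qed.

Lemma spread_remove n (T : nat -> bool) w a b c : T a -> T b -> T c ->
  [&& a + 3 <= b, b + 3 <= c, c + 3 <= a + n, a != w, b != w & c != w]%N ->
  spread n (fun i => T i && (i != w)).
Proof.
move=> Ta Tb Tc /and5P[ab bc ca aw /andP[bw cw]].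
by exists a, b, c; rewrite Ta Tb Tc.
Qed.

(* The hypotheses cleared here make lia split into too many cases. *)
Ltac mem :=
  repeat match goal with
  | H : is_true (has _ _) |- _ => clear H
  | H : is_true (~~ has _ _) |- _ => clear H
  | H : is_true (_ \notin _) |- _ => clear H
  end;
  rewrite ?mem_cat ?(mem_iota, inE, negb_or); lia.

Definition removable n (L : seq (seq nat)) (s : seq nat) (w : nat) : Prop :=
  [/\ has (fun i => i < n)%N s, (w < n)%N, w \notin s &
    forall T : nat -> bool, (forall i, T i -> (i < n)%N) -> spread n T ->
      all (has T) L -> ~~ has T s -> hitting n L (fun i => T i && (i != w))].

Lemma add_block n L s w : removable n L s w ->
  deformation_retract (cells R n (hitting n L)) (cells R n (hitting n (s :: L))).
Proof. by case=> sn wn ws h; exact: (hitting_collapse sn wn ws h). Qed.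

(** Meeting [s] entails meeting the larger [s'], whose condition is then dropped. *)
Lemma shrink_block n L s s' w : {subset s <= s'} -> removable n (s' :: L) s w ->
  deformation_retract (cells R n (hitting n (s' :: L)))
    (cells R n (hitting n (s :: L))).
Proof.
move=> ss' [sn wn ws h]; apply: (hitting_collapse sn wn ws h) => T /=.
rewrite andbA [has T s && has T s']andb_idr// => /hasP[x xs Tx].
by apply/hasP; exists x => //; exact: ss'.
Qed.

(** * The five collapses for n >= 11 *)

(* Descending on the least vertex [c] of [T]: it may serve as the first vertex of
   the triple, which makes [c.+1] irrelevant. *)
Lemma collapse_block1 n c : (11 <= n)%N -> (2 <= c <= n - 6)%N ->
  deformation_retract (cells R n (hitting n [::]))
    (cells R n (hitting n [:: iota 0 c])).
Proof.
move=> n11 /andP[c2 cn]; rewrite -[c](subKn cn).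
have : (n - 6 - c <= n - 8)%N by lia.
elim: (n - 6 - c)%N => [_|k IH kn]; rewrite ?subn0.
  (* Base case: six consecutive vertices hold no independent triple, so the condition on [n.-1] is
     vacuous. *)
  apply: (@add_block _ _ _ n.-1); split; [|lia|mem|].
    by apply/hasP; exists 0%N; mem.
  move=> T Tn [a [b [c' [Ta Tb Tc abc]]]] _ sT; exfalso.
  by have := notin_avoid sT Ta; have := Tn _ Tc; case: abc; mem.
apply: deformation_retract_trans (IH _) _; first by lia.
set d := (n - 6 - k.+1)%N; have -> : (n - 6 - k)%N = d.+1 by lia.
apply: (@shrink_block _ _ _ _ d.+1); first by move=> x; mem.
split; [|lia|mem|]; first by apply/hasP; exists 0%N; mem.
move=> T Tn [a [b [c' [Ta Tb Tc [ab bc ca]]]]] /andP[h1 _] sT.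
have Td : T d by apply: has_avoid h1 sT _ => x; mem.
have := notin_avoid sT Ta; have cn' := Tn _ Tc => na.
(* Replacing [a] by [d] keeps the gap across 0 because [d >= 2]; hence the descent stops at the
   block {0,1}. *)
split; first by apply: (spread_remove Td Tb Tc); move: na; mem.
by apply/andP; split=> //; apply: (has_remove _ Td); mem.
Qed.

(* From here on the triple is chosen greedily from the right end of the arc that
   remains when the block is removed. *)
Lemma collapse_block2 n : (11 <= n)%N ->
  deformation_retract (cells R n (hitting n [:: [:: 0; 1]]%N))
    (cells R n (hitting n [:: [:: 2; 3]; [:: 0; 1]]%N)).
Proof.
move=> n11; apply: (@deformation_retract_trans _ _ _
  (cells R n (hitting n [:: [:: 1; 2; 3]; [:: 0; 1]]%N))).
  apply: (@add_block _ _ _ n.-1); split; [by rewrite /=; lia|lia|mem|].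
  move=> T Tn [a [b [c [Ta Tb Tc [ab bc ca]]]]] /andP[h1 _] sT.
  have T0 : T 0%N by apply: has_avoid h1 sT _ => x; mem.
  have := notin_avoid sT Ta; have := notin_avoid sT Tb; have cn := Tn _ Tc => nb na.
  split; last by apply/andP; split=> //; apply: (has_remove _ T0); mem.
  (* A triple through 0 cannot use its neighbour [n.-1]. If 0 is missing, it is put in front and [c]
     is dropped. *)
  case: (posnP a) => a0; first by apply: (spread_remove Ta Tb Tc); move: na nb; mem.
  by apply: (spread_remove T0 Ta Tb); move: na nb; mem.
apply: (@shrink_block _ _ _ _ 0); first by move=> x; mem.
split; [by rewrite /=; lia|lia|mem|].
move=> T Tn [a [b [c [Ta Tb Tc [ab bc ca]]]]] /and3P[h2 h1 _] sT.
have T1 : T 1%N by apply: has_avoid h2 sT _ => x; mem.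
have := notin_avoid sT Ta; have := notin_avoid sT Tb; have cn := Tn _ Tc => nb na.
split; last by apply/and3P; split=> //; apply: (has_remove _ T1).
(* Here 1 can replace 0, since [b = 3] is excluded. *)
case: (posnP a) => a0; first by apply: (spread_remove T1 Tb Tc); move: na nb; mem.
by apply: (spread_remove Ta Tb Tc); move: na nb; mem.
Qed.

(* Sets avoiding 1, 3, 4, 5 contain 0 and 2, which must be kept; the toggled
   vertex is then the successor of the least element beyond 5. *)
Lemma collapse_block3_loop n k : (11 <= n)%N -> (k <= n - 9)%N ->
  deformation_retract (cells R n (hitting n [:: [:: 2; 3]; [:: 0; 1]]%N))
    (cells R n (hitting n [:: [:: 1; 3; 4; 5] ++ iota 6 k; [:: 2; 3]; [:: 0; 1]]%N)).
Proof.
move=> n11 kn; rewrite -[k](subKn kn).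
have : (n - 9 - k <= n - 9)%N by lia.
elim: (n - 9 - k)%N => [_|j IH jn]; rewrite ?subn0.
  (* Base case: [T] lies among the last three vertices, 0 and 2, within six cyclically consecutive
     vertices, so it has no triple. *)
  apply: (@add_block _ _ _ 0); split; [by rewrite /=; lia|lia|mem|].
  move=> T Tn [a [b [c [Ta Tb Tc [ab bc ca]]]]] _ sT; exfalso.
  have := notin_avoid sT Ta; have := notin_avoid sT Tb; have := notin_avoid sT Tc.
  by have := Tn _ Tc; mem.
apply: deformation_retract_trans (IH _) _; first by lia.
set d := (n - 9 - j.+1)%N; have -> : (n - 9 - j)%N = d.+1 by lia.
apply: (@shrink_block _ _ _ _ (7 + d)); first by move=> x; mem.
split; [by rewrite /=; lia|lia|mem|].
move=> T Tn [a [b [c [Ta Tb Tc [ab bc ca]]]]] /and4P[h3 h2 h1 _] sT.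
have Td : T (6 + d)%N by apply: has_avoid h3 sT _ => x; mem.
have T0 : T 0%N by apply: has_avoid h1 sT _ => x; mem.
have T2 : T 2%N by apply: has_avoid h2 sT _ => x; mem.
have := notin_avoid sT Ta; have := notin_avoid sT Tb; have cn := Tn _ Tc => nb na.
split; first by apply: (spread_remove T2 Td Tc); move: na nb; mem.
apply/and4P; split=> //; [apply: (has_remove _ Td)|apply: (has_remove _ T2)|
  apply: (has_remove _ T0)]; mem.
Qed.

(** From {1,3,4,5} the surplus vertices 1 and 3 are dropped, toggling 0 and 2. The dropped vertex
    lies in [T] and keeps the block of the toggled one met; a triple starting at 0 or 2 can start at
    2 or 3 instead. *)
Lemma collapse_block3 n : (11 <= n)%N ->
  deformation_retract (cells R n (hitting n [:: [:: 2; 3]; [:: 0; 1]]%N))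
    (cells R n (hitting n [:: [:: 4; 5]; [:: 2; 3]; [:: 0; 1]]%N)).
Proof.
move=> n11; apply: deformation_retract_trans (@collapse_block3_loop n 0 n11 _) _ => //.
apply: (@deformation_retract_trans _ _ _
  (cells R n (hitting n [:: [:: 3; 4; 5]; [:: 2; 3]; [:: 0; 1]]%N))).
  apply: (@shrink_block _ _ _ _ 0); first by move=> x; mem.
  split; [by rewrite /=; lia|lia|mem|].
  move=> T Tn [a [b [c [Ta Tb Tc [ab bc ca]]]]] /and4P[h3 h2 h1 _] sT.
  have T1 : T 1%N by apply: has_avoid h3 sT _ => x; mem.
  have T2 : T 2%N by apply: has_avoid h2 sT _ => x; mem.
  have := notin_avoid sT Ta; have := notin_avoid sT Tb; have cn := Tn _ Tc => nb na.
  split; last by apply/and4P; split=> //;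
    [apply: (has_remove _ T1)|apply: (has_remove _ T2)|apply: (has_remove _ T1)].
  case: (posnP a) => a0; first by apply: (spread_remove T2 Tb Tc); move: na nb; mem.
  by apply: (spread_remove Ta Tb Tc); move: na nb; mem.
apply: (@shrink_block _ _ _ _ 2); first by move=> x; mem.
split; [by rewrite /=; lia|lia|mem|].
move=> T Tn [a [b [c [Ta Tb Tc [ab bc ca]]]]] /and4P[h3 h2 h1 _] sT.
have T3 : T 3%N by apply: has_avoid h3 sT _ => x; mem.
have := notin_avoid sT Ta; have := notin_avoid sT Tb; have cn := Tn _ Tc => nb na.
split; last by apply/and4P; split=> //;
  [apply: (has_remove _ T3)|apply: (has_remove _ T3)|apply: has_removeN].
case: (eqVneq a 2%N) => a2; first by apply: (spread_remove T3 Tb Tc); move: na nb; mem.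
by apply: (spread_remove Ta Tb Tc); move: na nb; mem.
Qed.

(** Avoiding {1,3,5,6,7} forces 0, 2 and 4 into [T]. Then 1, 3 and 5 are dropped in turn, each
    replacing its even partner in the triple and in its block. *)
Lemma collapse_block4 n : (11 <= n)%N ->
  deformation_retract (cells R n (hitting n [:: [:: 4; 5]; [:: 2; 3]; [:: 0; 1]]%N))
    (cells R n (hitting n [:: [:: 6; 7]; [:: 4; 5]; [:: 2; 3]; [:: 0; 1]]%N)).
Proof.
move=> n11; apply: (@deformation_retract_trans _ _ _ (cells R n
    (hitting n [:: [:: 1; 3; 5; 6; 7]; [:: 4; 5]; [:: 2; 3]; [:: 0; 1]]%N))).
  apply: (@add_block _ _ _ n.-1); split; [by rewrite /=; lia|lia|mem|].
  move=> T Tn [a [b [c [Ta Tb Tc [ab bc ca]]]]] /and4P[h3 h2 h1 _] sT.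
  have T0 : T 0%N by apply: has_avoid h1 sT _ => x; mem.
  have T2 : T 2%N by apply: has_avoid h2 sT _ => x; mem.
  have T4 : T 4%N by apply: has_avoid h3 sT _ => x; mem.
  have := notin_avoid sT Ta; have := notin_avoid sT Tb; have := notin_avoid sT Tc.
  have cn := Tn _ Tc => nc nb na.
  split.
    (* One of [c], [b], [a] lies between 8 and [n - 3] and completes 0 and 4 to a triple. *)
    case: (leqP c (n - 3)) => c3.
      by apply: (spread_remove T0 T4 Tc); move: na nb nc; mem.
    case: (leqP a 4) => a4; first by apply: (spread_remove T0 T4 Tb); move: na nb; mem.
    by apply: (spread_remove T0 T4 Ta); move: na nb; mem.
  apply/and4P; split=> //; [apply: (has_remove _ T4)|apply: (has_remove _ T2)|
    apply: (has_remove _ T0)]; mem.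
apply: (@deformation_retract_trans _ _ _ (cells R n
    (hitting n [:: [:: 3; 5; 6; 7]; [:: 4; 5]; [:: 2; 3]; [:: 0; 1]]%N))).
  apply: (@shrink_block _ _ _ _ 0); first by move=> x; mem.
  split; [by rewrite /=; lia|lia|mem|].
  move=> T Tn [a [b [c [Ta Tb Tc [ab bc ca]]]]] /and5P[h4 h3 h2 h1 _] sT.
  have T1 : T 1%N by apply: has_avoid h4 sT _ => x; mem.
  have T2 : T 2%N by apply: has_avoid h2 sT _ => x; mem.
  have T4 : T 4%N by apply: has_avoid h3 sT _ => x; mem.
  have := notin_avoid sT Ta; have := notin_avoid sT Tb; have cn := Tn _ Tc => nb na.
  split; last by apply/and5P; split=> //; [apply: (has_remove _ T1)|
    apply: (has_remove _ T4)|apply: (has_remove _ T2)|apply: (has_remove _ T1)].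
  case: (posnP a) => a0; first by apply: (spread_remove T1 Tb Tc); move: na nb; mem.
  by apply: (spread_remove Ta Tb Tc); move: na nb; mem.
apply: (@deformation_retract_trans _ _ _ (cells R n
    (hitting n [:: [:: 5; 6; 7]; [:: 4; 5]; [:: 2; 3]; [:: 0; 1]]%N))).
  apply: (@shrink_block _ _ _ _ 2); first by move=> x; mem.
  split; [by rewrite /=; lia|lia|mem|].
  move=> T Tn [a [b [c [Ta Tb Tc [ab bc ca]]]]] /and5P[h4 h3 h2 h1 _] sT.
  have T3 : T 3%N by apply: has_avoid h4 sT _ => x; mem.
  have := notin_avoid sT Ta; have := notin_avoid sT Tb; have cn := Tn _ Tc => nb na.
  split.
    case: (eqVneq a 2%N) => a2.
      by apply: (spread_remove T3 Tb Tc); move: na nb; mem.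
    by apply: (spread_remove Ta Tb Tc); move: na nb; mem.
  apply/and5P; split=> //; try by apply: has_removeN => //; mem.
  by apply: (has_remove _ T3).
apply: (@shrink_block _ _ _ _ 4); first by move=> x; mem.
split; [by rewrite /=; lia|lia|mem|].
move=> T Tn [a [b [c [Ta Tb Tc [ab bc ca]]]]] /and5P[h4 h3 h2 h1 _] sT.
have T5 : T 5%N by apply: has_avoid h4 sT _ => x; mem.
have := notin_avoid sT Ta; have := notin_avoid sT Tb; have := notin_avoid sT Tc.
have cn := Tn _ Tc => nc nb na.
split.
  case: (eqVneq a 4%N) => a4.
    by apply: (spread_remove T5 Tb Tc); move: na nb; mem.
  case: (eqVneq b 4%N) => b4.
    by apply: (spread_remove Ta T5 Tc); move: na nc; mem.
  by apply: (spread_remove Ta Tb Tc); move: na nb; mem.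
apply/and5P; split=> //; try by apply: has_removeN => //; mem.
by apply: (has_remove _ T5).
Qed.

(** Below 7 the only triple is 0, 3, 6, so 1 is irrelevant. Once 7 is forced, it can replace 6, the
    gap from 7 to 0 being at least 3. *)
Lemma collapse_block5 n : (11 <= n)%N ->
  deformation_retract
    (cells R n (hitting n [:: [:: 6; 7]; [:: 4; 5]; [:: 2; 3]; [:: 0; 1]]%N))
    (cells R n (hitting n
       [:: iota 8 (n - 8); [:: 6; 7]; [:: 4; 5]; [:: 2; 3]; [:: 0; 1]]%N)).
Proof.
move=> n11; apply: (@deformation_retract_trans _ _ _ (cells R n
    (hitting n [:: iota 7 (n - 7); [:: 6; 7]; [:: 4; 5]; [:: 2; 3]; [:: 0; 1]]%N))).
  apply: (@add_block _ _ _ 1); split; [|lia|mem|].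
    by apply/hasP; exists 7%N; mem.
  move=> T Tn [a [b [c [Ta Tb Tc [ab bc ca]]]]] /and5P[h4 h3 h2 h1 _] sT.
  have := notin_avoid sT Tc; have cn := Tn _ Tc => nc.
  have [a0 b3] : a = 0%N /\ b = 3%N by move: nc; mem.
  split; first by apply: (spread_remove Ta Tb Tc); move: nc; mem.
  apply/and5P; split=> //; try by apply: has_removeN => //; mem.
  by apply: (has_remove _ Ta); mem.
apply: (@shrink_block _ _ _ _ 6); first by move=> x; mem.
split; [|lia|mem|]; first by apply/hasP; exists 8%N; mem.
move=> T Tn [a [b [c [Ta Tb Tc [ab bc ca]]]]] LT sT.
have /andP[h5 /and5P[h4 h3 h2 h1 _]] := LT.
have T7 : T 7%N by apply: has_avoid h5 sT _ => x; mem.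
have := notin_avoid sT Tc; have cn := Tn _ Tc => nc.
split.
  case: (eqVneq c 6%N) => c6; first by apply: (spread_remove Ta Tb T7); mem.
  by apply: (spread_remove Ta Tb Tc); move: nc; mem.
apply/andP; split; first by apply: (has_remove _ T7); mem.
apply/and5P; split=> //; try by apply: has_removeN => //; mem.
by apply: (has_remove _ T7); mem.
Qed.

(** * The sphere for n >= 11 *)

(** Vertices of blocks that are not cyclic neighbours are at least 3 apart, so only neighbouring
    pairs need testing. If all four tests fail, then [n = 11] and the vertices are 0, 2, 4, 7, 9,
    with triple 0, 4, 7. *)
Lemma spread_transversal n (T : nat -> bool) i1 i2 i3 i4 i5 : (11 <= n)%N ->
  T i1 -> T i2 -> T i3 -> T i4 -> T i5 ->
  [&& i1 < 2, 2 <= i2 < 4, 4 <= i3 < 6, 6 <= i4 < 8 & 8 <= i5 < n]%N ->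
  spread n T.
Proof.
move=> n11 T1 T2 T3 T4 T5 /and5P[h1 h2 h3 h4 h5].
case: (leqP (i5 + 3) (i1 + n)) => h15.
  by exists i1, i3, i5; split=> //; split; lia.
case: (leqP (i4 + 3) i5) => h45.
  by exists i2, i4, i5; split=> //; split; lia.
case: (leqP (i2 + 3) i3) => h23.
  by exists i2, i3, i5; split=> //; split; lia.
case: (leqP (i1 + 3) i2) => h12.
  by exists i1, i2, i4; split=> //; split; lia.
by exists i1, i3, i4; split=> //; split; lia.
Qed.

Lemma sphere_large n : (11 <= n)%N ->
  homotopy_equivalent (realization (total_cut_face (@sqcycle_adj n) 3))
    (sphere (n - 6)).
Proof.
move=> n11; pose r i := minn i./2.*2 8.
have defL := deformation_retract_trans (deformation_retract_trans
  (deformation_retract_trans (deformation_retract_trans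
    (@collapse_block1 n 2 n11 _) (collapse_block2 n11)) (collapse_block3 n11))
  (collapse_block4 n11)) (collapse_block5 n11).
apply: (hitting_sphere _ (defL _) (r := r)) => {defL}.
- by lia.
- by lia.
- by move=> i; rewrite /r; lia.
- by move=> i; rewrite /r; lia.
- rewrite -(subnKC n11) iotaD count_cat /=.
  rewrite (@eq_in_count _ _ predT); last by move=> i; rewrite mem_iota /r /=; lia.
  by rewrite count_predT size_iota; lia.
move=> T Tn; split=> [[_]|h].
  case/andP=> h5 /and5P[h4 h3 h2 h1 _] i ltin.
  have pick s : has T s -> (forall x, x \in s -> r x = r i) ->
      exists2 j, r j = r i & T j.
    by move=> /hasP[x xs Tx] rx; exists x => //; exact: rx.
  case: (ltnP i 2) => i2; first by apply: pick h1 _ => x; rewrite /r; mem.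
  case: (ltnP i 4) => i4; first by apply: pick h2 _ => x; rewrite /r; mem.
  case: (ltnP i 6) => i6; first by apply: pick h3 _ => x; rewrite /r; mem.
  case: (ltnP i 8) => i8; first by apply: pick h4 _ => x; rewrite /r; mem.
  by apply: pick h5 _ => x; rewrite /r; mem.
have lt_n k : (k < 11)%N -> (k < n)%N by lia.
have [i1 r1 T1] := h 0%N (lt_n 0%N isT); have [i2 r2 T2] := h 2%N (lt_n 2%N isT).
have [i3 r3 T3] := h 4%N (lt_n 4%N isT); have [i4 r4 T4] := h 6%N (lt_n 6%N isT).
have [i5 r5 T5] := h 8%N (lt_n 8%N isT); have i5n := Tn _ T5.
have b1 : (i1 < 2)%N by move: r1; rewrite /r; clear; lia.
have b2 : (2 <= i2 < 4)%N by move: r2; rewrite /r; clear; lia.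
have b3 : (4 <= i3 < 6)%N by move: r3; rewrite /r; clear; lia.
have b4 : (6 <= i4 < 8)%N by move: r4; rewrite /r; clear; lia.
have b5 : (8 <= i5 < n)%N by move: r5 i5n; rewrite /r; clear; lia.
clear r1 r2 r3 r4 r5; split.
  by apply: (spread_transversal n11 T1 T2 T3 T4 T5); rewrite b1 b2 b3 b4 b5.
by apply/and5P; split; [| | | |rewrite andbT]; apply/hasP;
  [exists i5|exists i4|exists i3|exists i2|exists i1] => //; mem.
Qed.

Theorem theorem3p2 (n : nat) :
  (9 <= n)%N ->
  homotopy_equivalent
    (realization (total_cut_face (@sqcycle_adj n) 3))
    (sphere (if (n <= 10)%N then (2 * n - 17)%N else (n - 6)%N)).
Proof.
case: (ltnP 10 n) => [n11 _|n10 n9]; first exact: sphere_large.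
have [-> | ->] : n = 9%N \/ n = 10%N by lia.
  exact: sphere_case9.
exact: sphere_case10.
Qed.
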